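(* Let $m$ be a positive integer and let $M$ be a matroid with no loops and with $r(M)>2$. Then the free $m$-cone $Q_m(M)$ of $M$ is configuration unique.
   Context: For a matroid $M$, a set $X\subseteq E(M)$ and $e\notin E(M)$, the principal extension $M+_Xe$ is the matroid on $E(M)\cup e$ with rank function $r'(Y)=r_M(Y)$ and $r'(Y\cup e)=r_M(Y)$ if $X\subseteq\mathrm{cl}_M(Y)$, $r'(Y\cup e)=r_M(Y)+1$ otherwise, for $Y\subseteq E(M)$ (''adding $e$ freely to $X$''). For a loopless matroid $M$ and positive integer $m$, the free $m$-cone $Q_m(M)$ is obtained by first adding a coloop $a$ to $M$ and then, by iterated principal extensions, for each $e\in E(M)$ adding $m$ new elements freely to the line $\mathrm{cl}(\{a,e\})$. A cyclic flat is a flat that is a union of circuits; cyclic flats form a lattice $\mathcal{Z}(M)$ under inclusion. Matroids $M,N$ have the same configuration if $|E(M)|=|E(N)|$ and there is a lattice isomorphism $\Phi:\mathcal{Z}(M)\to\mathcal{Z}(N)$ with $|\Phi(F)|=|F|$ and $r_N(\Phi(F))=r_M(F)$ for all $F$; a matroid is configuration unique if every matroid with the same configuration is isomorphic to it. *)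

(* Defs.v *)
From HB Require Import structures.
From mathcomp Require Import all_boot all_order.

Set Implicit Arguments.
Unset Strict Implicit.
Unset Printing Implicit Defensive.

(* A matroid is given by a ground set inside an ambient finite type and a rank
   function.  The rank function is defined on all subsets of the ambient type,
   but [rk_ground] makes it depend only on the part inside the ground set. *)
Record matroid (T : finType) := Matroid {
  ground : {set T};
  rk : {set T} -> nat;
  rk_ground : forall A : {set T}, rk (A :&: ground) = rk A;
  rk_card : forall A : {set T}, rk A <= #|A|;
  rk_mono : forall A B : {set T}, A \subset B -> rk A <= rk B;
  rk_submod : forall A B : {set T}, rk (A :|: B) + rk (A :&: B) <= rk A + rk B
}.

Fact cyclic_flat_display : Order.disp_t.
Proof. exact: (Order.Disp tt tt). Qed.

Section Notions.
Variables (T : finType) (M : matroid T).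
Implicit Types (A B C X : {set T}) (x : T).

Definition rank : nat := rk M (ground M).

Definition dependent X : bool := (X \subset ground M) && (rk M X < #|X|).

Definition circuit C : bool := minset dependent C.

Definition loopless : Prop := forall x, x \in ground M -> rk M [set x] != 0.

Definition cl A : {set T} := [set x in ground M | rk M (x |: A) == rk M A].

Definition flat (F : {set T}) : bool := (F \subset ground M) && (cl F == F).

Definition cyclic A : bool :=
  [exists P : {set {set T}}, [forall C in P, circuit C] && (cover P == A)].

Record cyclic_flat := CyclicFlat {
  cf_set :> {set T};
  cf_setP : flat cf_set && cyclic cf_set
}.

Lemma cl_eqI A : cl (A :&: ground M) = cl A.
Proof.
apply/setP=> x; rewrite !inE rk_ground.
case xE: (x \in ground M) => //=; rewrite -(rk_ground M (x |: A)) setIUl.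
by rewrite (setIidPl _ : [set x] :&: ground M = [set x]) // sub1set xE.
Qed.

Lemma cl_ground A : cl A \subset ground M.
Proof. by apply/subsetP=> x; rewrite inE => /andP[]. Qed.

Lemma cl_sub A : A \subset ground M -> A \subset cl A.
Proof.
move=> AE; apply/subsetP=> x xA; rewrite inE (subsetP AE) //=.
by rewrite (setUidPr _) // sub1set.
Qed.

Lemma rk_absorb A B :
  (forall y, y \in A -> rk M (y |: B) = rk M B) -> rk M (B :|: A) = rk M B.
Proof.
elim: {A}_.+1 {-2}A (ltnSn #|A|) => // n IHn A; rewrite ltnS => An AB.
have [->|[y yA]] := set_0Vmem A; first by rewrite setU0.
have IH : rk M (B :|: A :\ y) = rk M B.
  apply: IHn => [|z]; last by rewrite inE => /andP[_ /AB].
  by rewrite (leq_trans _ An) // (cardsD1 y A) yA.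
apply/eqP; rewrite eqn_leq (rk_mono _ (subsetUl _ _)) andbT.
have := rk_submod M (y |: B) (B :|: A :\ y); rewrite IH (AB y yA).
have -> : (y |: B) :|: (B :|: A :\ y) = B :|: A.
  by rewrite -[in RHS](setD1K yA) -setUA (setUA B B) setUid setUCA.
have sB : B \subset (y |: B) :&: (B :|: A :\ y) by rewrite subsetI subsetUr subsetUl.
move=> h; have := leq_trans (leq_add (leqnn _) (rk_mono M sB)) h.
by rewrite leq_add2r.
Qed.

Lemma rk_cl A : A \subset ground M -> rk M (cl A) = rk M A.
Proof.
move=> AE; rewrite -(@rk_absorb (cl A) A) => [|y]; last by rewrite inE => /andP[_ /eqP].
by rewrite (setUidPr _) // cl_sub.
Qed.

Lemma cl_mono A B : A \subset B -> cl A \subset cl B.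
Proof.
move=> AB; apply/subsetP=> x; rewrite !inE => /andP[-> /eqP xA] /=.
rewrite eqn_leq (rk_mono _ (subsetUr _ _)) andbT.
have := rk_submod M (x |: A) B; rewrite xA -setUA (setUidPr AB).
have sA : A \subset (x |: A) :&: B by rewrite subsetI subsetUr.
move=> h; have := leq_trans (leq_add (leqnn _) (rk_mono M sA)) h.
by rewrite addnC leq_add2l.
Qed.

Lemma cl_flat A : A \subset ground M -> flat (cl A).
Proof.
move=> AE; rewrite /flat cl_ground /= eqEsubset (cl_sub (cl_ground A)) andbT.
apply/subsetP=> x; rewrite !inE => /andP[-> /eqP xA] /=.
rewrite eqn_leq (rk_mono _ (subsetUr _ _)) andbT -(rk_cl AE) -xA rk_mono //.
by rewrite setUS ?cl_sub.
Qed.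

Lemma circuit_through A x :
  A \subset ground M -> x \in cl A -> x \notin A ->
  exists C, [/\ circuit C, x \in C & C \subset x |: A].
Proof.
move=> AE xA xNA.
pose P B := (B \subset A) && (rk M B == #|B|).
have P0 : P set0 by rewrite /P sub0set cards0 -leqn0 -(cards0 T) rk_card.
have [B /maxsetP[/andP[BA /eqP rB] maxB] _] := maxset_exists P0.
have rBA : rk M A = #|B|.
  rewrite -rB -(@rk_absorb A B) ?(setUidPr BA) // => y yA.
  have [yB|yNB] := boolP (y \in B); first by rewrite (setUidPr _) // sub1set.
  apply/eqP; rewrite eqn_leq (rk_mono _ (subsetUr _ _)) andbT leqNgt rB.
  apply: contra yNB => lt; rewrite -(maxB (y |: B)) ?setU11 ?subsetUr //.
  rewrite /P subUset sub1set yA BA eqn_leq rk_card /=.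
  by apply: leq_trans lt; rewrite cardsU1; case: (y \in B).
have xE : x \in ground M by apply: (subsetP (cl_ground A)).
have dxB : dependent (x |: B).
  rewrite /dependent subUset sub1set xE (subset_trans BA AE) /=.
  rewrite cardsU1 (contra (subsetP BA x)) //= add1n ltnS -rBA.
  move: xA; rewrite inE => /andP[_ /eqP <-]; by rewrite rk_mono ?setUS.
have [C Cc CxB] := minset_exists dxB.
exists C; split=> //; last by rewrite (subset_trans CxB) ?setUS.
have /minsetP[/andP[_ dC] _] := Cc.
apply: contraTT dC => xNC; rewrite -leqNgt.
have CB : C \subset B.
  apply/subsetP=> y yC; have /setU1P[yx|//] := subsetP CxB y yC.
  by rewrite yx (negPf xNC) in yC *.
have := rk_submod M C (B :\: C); rewrite setDE setUIr setUCr setIT.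
rewrite (setUidPr CB) rB -setDE -(cardsID C B) (setIidPr CB) => h.
rewrite -(leq_add2r #|B :\: C|); apply: leq_trans (leq_addr _ _) (leq_trans h _).
by rewrite leq_add2l rk_card.
Qed.

Lemma cyclicP A :
  reflect (forall x, x \in A -> exists C, [/\ circuit C, x \in C & C \subset A])
          (cyclic A).
Proof.
apply: (iffP existsP) => [[P /andP[/forall_inP Pc /eqP <-]] x|h].
  case/bigcupP=> C CP xC; exists C; split=> //; first exact: Pc.
  exact: bigcup_sup.
exists [set C | circuit C && (C \subset A)]; apply/andP; split.
  by apply/forall_inP=> C; rewrite inE => /andP[].
rewrite eqEsubset; apply/andP; split.
  by apply/bigcupsP=> C; rewrite inE => /andP[].
apply/subsetP=> x /h[C [Cc xC CA]]; apply/bigcupP; exists C => //.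
by rewrite inE Cc.
Qed.

(* The largest union of circuits inside a set. *)
Definition cyclic_part A : {set T} :=
  \bigcup_(C | circuit C && (C \subset A)) C.

Lemma cyclic_partS A : cyclic_part A \subset A.
Proof. by apply/bigcupsP=> C /andP[]. Qed.

Lemma cyclic_part_sup A C : circuit C -> C \subset A -> C \subset cyclic_part A.
Proof. by move=> Cc CA; apply: (bigcup_sup C) => //; rewrite Cc. Qed.

Lemma cyclic_flat_join_subproof (F G : cyclic_flat) :
  flat (cl (F :|: G)) && cyclic (cl (F :|: G)).
Proof.
case: F G => [F /andP[/andP[FE _] /cyclicP Fc]] [G /andP[/andP[GE _] /cyclicP Gc]] /=.
have UE : F :|: G \subset ground M by rewrite subUset FE.
have Ucl := cl_sub UE; rewrite cl_flat //=; apply/cyclicP=> x xcl.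
have [/setUP[/Fc|/Gc]|xN] := boolP (x \in F :|: G).
- case=> C [Cc xC CF]; exists C; split=> //.
  by rewrite (subset_trans CF) // (subset_trans _ Ucl) ?subsetUl.
- case=> C [Cc xC CG]; exists C; split=> //.
  by rewrite (subset_trans CG) // (subset_trans _ Ucl) ?subsetUr.
have [C [Cc xC CU]] := circuit_through UE xcl xN; exists C; split=> //.
by rewrite (subset_trans CU) // subUset sub1set xcl.
Qed.

Lemma cyclic_flat_meet_subproof (F G : cyclic_flat) :
  flat (cyclic_part (F :&: G)) && cyclic (cyclic_part (F :&: G)).
Proof.
case: F G => [F /andP[/andP[FE /eqP Fcl] _]] [G /andP[/andP[GE /eqP Gcl] _]] /=.
set K := cyclic_part _.
have KFG : K \subset F :&: G by apply: cyclic_partS.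
have [KF KG] : K \subset F /\ K \subset G by apply/andP; rewrite -subsetI.
have KE : K \subset ground M by apply: subset_trans FE.
apply/andP; split; last first.
  apply/cyclicP=> x /bigcupP[C /andP[Cc CFG] xC].
  by exists C; split=> //; apply: cyclic_part_sup.
rewrite /flat KE /= eqEsubset (cl_sub KE) andbT; apply/subsetP=> x xK.
have [//|xN] := boolP (x \in K).
have [C [Cc xC CxK]] := circuit_through KE xK xN.
suff CK : C \subset K by rewrite (subsetP CK) in xN.
apply: cyclic_part_sup => //; apply: subset_trans CxK _.
by rewrite subUset KFG sub1set inE -{1}Fcl -{1}Gcl !(subsetP (cl_mono _) _ xK).
Qed.

HB.instance Definition _ := [isSub for cf_set].
HB.instance Definition _ := [Finite of cyclic_flat by <:].

Definition cf_le (F G : cyclic_flat) : bool := cf_set F \subset cf_set G.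

Definition cf_join (F G : cyclic_flat) : cyclic_flat :=
  CyclicFlat (cyclic_flat_join_subproof F G).

Definition cf_meet (F G : cyclic_flat) : cyclic_flat :=
  CyclicFlat (cyclic_flat_meet_subproof F G).

Lemma cf_le_refl : reflexive cf_le.
Proof. by move=> F; apply: subxx. Qed.

Lemma cf_le_anti : antisymmetric cf_le.
Proof. by move=> F G FG; apply/val_inj/eqP; rewrite eqEsubset. Qed.

Lemma cf_le_trans : transitive cf_le.
Proof. by move=> F G H; apply: subset_trans. Qed.

Lemma cf_meetP (F G H : cyclic_flat) : cf_le F (cf_meet G H) = cf_le F G && cf_le F H.
Proof.
rewrite /cf_le /= -subsetI; apply/idP/idP => FGH.
  exact: subset_trans FGH (cyclic_partS _).
have /andP[_ /cyclicP Fc] := cf_setP F; apply/subsetP=> x /Fc[C [Cc xC CF]].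
by apply: (subsetP (cyclic_part_sup Cc (subset_trans CF FGH))).
Qed.

Lemma cf_joinP (F G H : cyclic_flat) : cf_le (cf_join F G) H = cf_le F H && cf_le G H.
Proof.
have /andP[/andP[FE _] _] := cf_setP F; have /andP[/andP[GE _] _] := cf_setP G.
have /andP[/andP[_ /eqP Hcl] _] := cf_setP H.
rewrite /cf_le /= -subUset; apply/idP/idP => FGH.
  by apply: subset_trans FGH; rewrite cl_sub // subUset FE.
by rewrite -Hcl cl_mono.
Qed.

HB.instance Definition _ :=
  Order.Le_isPOrder.Build cyclic_flat_display cyclic_flat
    cf_le_refl cf_le_anti cf_le_trans.
HB.instance Definition _ :=
  Order.POrder_MeetJoin_isLattice.Build _ cyclic_flat cf_meetP cf_joinP.

End Notions.

Section Extensions.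
Variables (T : finType) (M : matroid T) (e : T).
Implicit Types A B X : {set T}.

Let rkD1_ground A : rk M ((A :&: (e |: ground M)) :\ e) = rk M (A :\ e).
Proof.
rewrite -[LHS]rk_ground -[RHS]rk_ground; congr (rk M _).
by apply/setP=> x; rewrite !inE; case: eqP => // _; case: (x \in A); rewrite //= andbb.
Qed.

Let rkD1_ground_cl A : cl M ((A :&: (e |: ground M)) :\ e) = cl M (A :\ e).
Proof.
rewrite -[LHS]cl_eqI -[RHS]cl_eqI; congr (cl M _).
by apply/setP=> x; rewrite !inE; case: eqP => // _; case: (x \in A); rewrite //= andbb.
Qed.

Section Pext.
Variable X : {set T}.

Definition pext_rk A : nat :=
  rk M (A :\ e) + ((e \in A) && ~~ (X \subset cl M (A :\ e))).

Lemma pext_ground A : pext_rk (A :&: (e |: ground M)) = pext_rk A.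
Proof. by rewrite /pext_rk rkD1_ground rkD1_ground_cl !inE eqxx andbT. Qed.

Lemma pext_card A : pext_rk A <= #|A|.
Proof.
rewrite /pext_rk (cardsD1 e A) addnC leq_add ?rk_card //.
by case: (e \in A) => //=; rewrite leq_b1.
Qed.

Let pext_gain A B : A \subset B ->
  rk M A + ~~ (X \subset cl M A) <= rk M B + ~~ (X \subset cl M B).
Proof.
move=> AB; have rAB := rk_mono M AB.
have [XA|/subsetPn[x xX xNA]] := boolP (X \subset cl M A).
  by rewrite addn0 (leq_trans rAB) ?leq_addr.
have [XB|_] := boolP (X \subset cl M B); last by rewrite leq_add2r.
rewrite /= addn1 addn0 ltn_neqAle rAB andbT; apply: contraNneq xNA => eqAB.
have := subsetP XB x xX; rewrite !inE => /andP[-> /eqP xB] /=.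
by rewrite eqn_leq (rk_mono _ (subsetUr _ _)) andbT eqAB -xB rk_mono ?setUS.
Qed.

Lemma pext_mono A B : A \subset B -> pext_rk A <= pext_rk B.
Proof.
move=> AB; have ABe : A :\ e \subset B :\ e by rewrite setSD.
rewrite /pext_rk; have [eA|_] /= := boolP (e \in A).
  by rewrite (subsetP AB _ eA) /= pext_gain.
by rewrite addn0 (leq_trans (rk_mono M ABe)) ?leq_addr.
Qed.

Let pext_gain_submod A B :
  rk M (A :|: B) + ~~ (X \subset cl M (A :|: B)) +
    (rk M (A :&: B) + ~~ (X \subset cl M (A :&: B))) <=
  rk M A + ~~ (X \subset cl M A) + (rk M B + ~~ (X \subset cl M B)).
Proof.
have sub := rk_submod M A B; rewrite addnACA [leqRHS]addnACA.
have UA : X \subset cl M A -> X \subset cl M (A :|: B).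
  by move/subset_trans; apply; rewrite cl_mono ?subsetUl.
have UB : X \subset cl M B -> X \subset cl M (A :|: B).
  by move/subset_trans; apply; rewrite cl_mono ?subsetUr.
have [XA|_] := boolP (X \subset cl M A); last first.
  have [XB|_] := boolP (X \subset cl M B); last first.
    by rewrite leq_add // leq_add ?leq_b1.
  by rewrite UB //= leq_add // leq_b1.
rewrite UA //=.
have [XB|_] := boolP (X \subset cl M B); last by rewrite leq_add // leq_b1.
have [_|/subsetPn[x xX]] := boolP (X \subset cl M (A :&: B)).
  by rewrite /= !addn0.
have := subsetP XA x xX; have := subsetP XB x xX; rewrite !inE.
move=> /andP[-> /eqP xB] /andP[_ /eqP xA] /= xN.
rewrite add0n addn1 !addn0 -addnS -[in leqRHS]xA -[in leqRHS]xB.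
apply: leq_trans (rk_submod _ _ _); rewrite -setUIr leq_add //.
  by rewrite rk_mono // setUSS ?subsetUr.
by rewrite ltn_neqAle eq_sym xN rk_mono ?subsetUr.
Qed.

Lemma pext_submod A B :
  pext_rk (A :|: B) + pext_rk (A :&: B) <= pext_rk A + pext_rk B.
Proof.
have sub := rk_submod M (A :\ e) (B :\ e).
rewrite /pext_rk !inE setDUl setDIl.
have [eA|_] /= := boolP (e \in A); have [eB|_] /= := boolP (e \in B);
  rewrite ?addn0 //.
- have [XA|_] /= := boolP (X \subset cl M (A :\ e)).
    by rewrite (subset_trans XA) ?cl_mono ?subsetUl //= !addn0.
  by rewrite addnAC [leqRHS]addnAC leq_add // leq_b1.
- have [XB|_] /= := boolP (X \subset cl M (B :\ e)).
    by rewrite (subset_trans XB) ?cl_mono ?subsetUr //= !addn0.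
  by rewrite addnAC addnA leq_add // leq_b1.
Qed.

(* Only meaningful as the principal extension of M when e is not in the ground
   set of M and X is a subset of the ground set; [principal_ext_rk] and
   [principal_ext_rkU1] then give the usual two-case description. *)
Definition principal_ext : matroid T :=
  Matroid pext_ground pext_card pext_mono pext_submod.

Lemma principal_ext_rk A : e \notin A -> rk principal_ext A = rk M A.
Proof.
move=> eA; rewrite /= /pext_rk (negPf eA) addn0; congr (rk M _).
by apply/setDidPl; rewrite disjoint_sym disjoints1.
Qed.

Lemma principal_ext_rkU1 A : e \notin A ->
  rk principal_ext (e |: A) =
    if X \subset cl M A then rk M A else (rk M A).+1.
Proof.
move=> eA; rewrite /= /pext_rk setU11 setU1K //.
by case: (X \subset cl M A); rewrite ?addn0 ?addn1.
Qed.

End Pext.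

Definition coloop_rk A : nat := rk M (A :\ e) + (e \in A).

Lemma coloop_ground A : coloop_rk (A :&: (e |: ground M)) = coloop_rk A.
Proof. by rewrite /coloop_rk rkD1_ground !inE eqxx andbT. Qed.

Lemma coloop_card A : coloop_rk A <= #|A|.
Proof. by rewrite /coloop_rk (cardsD1 e A) addnC leq_add ?rk_card. Qed.

Lemma coloop_mono A B : A \subset B -> coloop_rk A <= coloop_rk B.
Proof.
move=> AB; rewrite leq_add ?rk_mono ?setSD //.
by case eA: (e \in A) => //; rewrite (subsetP AB).
Qed.

Lemma coloop_submod A B :
  coloop_rk (A :|: B) + coloop_rk (A :&: B) <= coloop_rk A + coloop_rk B.
Proof.
rewrite /coloop_rk addnACA [leqRHS]addnACA setDUl setDIl leq_add ?rk_submod //.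
by rewrite !inE; case: (e \in A); case: (e \in B).
Qed.

(* For e outside the ground set of M. *)
Definition add_coloop : matroid T :=
  Matroid coloop_ground coloop_card coloop_mono coloop_submod.

End Extensions.

Section FreeCone.
Variables (T : finType) (M : matroid T) (m : nat).

(* [inl x] is the element x of M, [inr None] is the tip, and [inr (Some (x, i))]
   is the i-th element added freely to the line spanned by the tip and x. *)
Definition cone_type : finType := (T + option (T * 'I_m))%type.
Implicit Types A B : {set cone_type}.

Definition tip : cone_type := inr None.

Definition base_ground : {set cone_type} := inl @: ground M.
Definition base_rk A : nat := rk M (inl @^-1: A).

Lemma base_rk_ground A : base_rk (A :&: base_ground) = base_rk A.
Proof.
rewrite /base_rk preimsetI -[RHS]rk_ground; congr (rk M (_ :&: _)).
by apply/setP=> x; rewrite inE mem_imset //; apply: inl_inj.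
Qed.

Lemma base_card A : base_rk A <= #|A|.
Proof.
apply: leq_trans (rk_card _ _) _.
rewrite -(card_imset (inl @^-1: A) (@inl_inj T (option (T * 'I_m)))).
by apply/subset_leq_card/subsetP=> _ /imsetP[x xA ->]; rewrite inE in xA.
Qed.

Lemma base_mono A B : A \subset B -> base_rk A <= base_rk B.
Proof. by move=> AB; rewrite rk_mono ?preimsetS. Qed.

Lemma base_submod A B :
  base_rk (A :|: B) + base_rk (A :&: B) <= base_rk A + base_rk B.
Proof. by rewrite /base_rk preimsetU preimsetI rk_submod. Qed.

(* The copy of M inside [cone_type]. *)
Definition cone_base : matroid cone_type :=
  Matroid base_rk_ground base_card base_mono base_submod.

Definition free_cone : matroid cone_type :=
  foldl (fun (N : matroid cone_type) (p : T * 'I_m) =>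
           principal_ext N (inr (Some p)) (cl N [set tip; inl p.1]))
    (add_coloop cone_base tip)
    (enum [set p : T * 'I_m | p.1 \in ground M]).

End FreeCone.

Definition same_configuration (T U : finType) (M : matroid T) (N : matroid U) :
    Prop :=
  #|ground M| = #|ground N| /\
  exists Phi : cyclic_flat M -> cyclic_flat N,
    [/\ bijective Phi,
        {morph Phi : F G / (F `&` G)%O},
        {morph Phi : F G / (F `|` G)%O},
        forall F, #|cf_set (Phi F)| = #|cf_set F| &
        forall F, rk N (Phi F) = rk M F].

Definition isomorphic (T U : finType) (M : matroid T) (N : matroid U) : Prop :=
  exists2 f : {x | x \in ground M} -> {y | y \in ground N},
    bijective f &
    forall A : {set {x | x \in ground M}},
      rk N (val @: (f @: A)) = rk M (val @: A).

Definition configuration_unique (T : finType) (M : matroid T) : Prop :=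
  forall (U : finType) (N : matroid U), same_configuration M N -> isomorphic M N.

(* Main.v *)
(* A rank function is determined by the ranks of the cyclic flats, so it suffices
   to find a bijection E(Q) -> E(N), Q the free cone, carrying each cyclic flat F
   onto Phi(F).  The images of two planes of Q on a common line L through the tip a
   meet exactly in Phi(L).  As Q has rank at least 4, this forces the images of all
   lines through a to be concurrent as soon as two of them meet, and pairwise
   disjoint images would have too many points.  So the Phi(L) share a point b and,
   by counting, otherwise partition E(N), which settles the cyclic flats
   containing a.  For a cyclic flat G avoiding a, |Phi(G) n Phi(L)| <= |G n L| for
   every L, and summing over L gives equality.  All such G lie in a largest one,
   Gmax, so any bijection sending a to b, each L to Phi(L) and Gmax to Phi(Gmax)
   will do. *)
Require Import Defs.
From mathcomp Require Import all_boot all_order.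

Set Implicit Arguments.
Unset Strict Implicit.
Unset Printing Implicit Defensive.

(** * Flats and cyclic flats *)

Section MatroidFacts.
Variables (T : finType) (M : matroid T).
Implicit Types (A B F G K X : {set T}) (x y : T).

Lemma rk_set0 : rk M set0 = 0.
Proof. by apply/eqP; rewrite -leqn0 -(cards0 T) rk_card. Qed.

Lemma rkU1 x A : rk M (x |: A) <= (rk M A).+1.
Proof.
have := rk_submod M [set x] A; have := rk_card M [set x]; rewrite cards1 => h1 h2.
by rewrite -add1n; apply: leq_trans (leq_trans (leq_addr _ _) h2) _; rewrite leq_add2r.
Qed.

Lemma flat_ground F : flat M F -> F \subset ground M.
Proof. by case/andP. Qed.

Lemma mem_cl A x : x \in ground M -> rk M (x |: A) <= rk M A -> x \in cl M A.
Proof. by move=> xE h; rewrite inE xE eqn_leq h rk_mono ?subsetUr. Qed.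

Lemma cl_min A F : flat M F -> A \subset F -> cl M A \subset F.
Proof. by case/andP=> _ /eqP {2}<- /cl_mono. Qed.

Lemma rk_notin_flat F x :
  flat M F -> x \in ground M -> x \notin F -> rk M (x |: F) = (rk M F).+1.
Proof.
move=> /andP[_ /eqP Fcl] xE; rewrite -{1}Fcl => xN; apply/eqP.
by rewrite eqn_leq rkU1 ltnNge; apply: contra xN; apply: mem_cl.
Qed.

Lemma flatI F G : flat M F -> flat M G -> flat M (F :&: G).
Proof.
move=> fF fG; have IE : F :&: G \subset ground M.
  by rewrite (subset_trans (subsetIl _ _)) ?flat_ground.
rewrite /flat IE eqEsubset cl_sub // andbT subsetI.
by rewrite !cl_min ?subsetIl ?subsetIr.
Qed.

Lemma flat_rk_eq F G :
  flat M F -> G \subset ground M -> F \subset G -> rk M G <= rk M F -> F = G.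
Proof.
move=> fF GE FG rGF; apply/eqP; rewrite eqEsubset FG; apply/subsetP=> x xG.
apply: contraTT rGF => xF; rewrite -ltnNge -(rk_notin_flat fF _ xF) ?(subsetP GE) //.
by rewrite rk_mono // subUset sub1set xG.
Qed.

Lemma flat_rk_lt F G :
  flat M F -> G \subset ground M -> F \proper G -> rk M F < rk M G.
Proof.
move=> fF GE /properP[FG [x xG xF]]; rewrite -(rk_notin_flat fF _ xF) ?(subsetP GE) //.
by rewrite rk_mono // subUset sub1set xG.
Qed.

(** [F :&: G] is a flat strictly below [F], so its rank is at most that of [D], which it
    contains. *)
Lemma flat_cover_meet D F G :
    flat M D -> flat M F -> flat M G -> D \subset F -> D \subset G ->
    rk M F = (rk M D).+1 -> rk M G = (rk M D).+1 -> F <> G ->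
  F :&: G = D.
Proof.
move=> fD fF fG DF DG rF rG FG; apply/esym/flat_rk_eq => //.
- exact/flat_ground/flatI.
- by rewrite subsetI DF.
rewrite -ltnS -rF; apply: flat_rk_lt; rewrite ?flatI ?flat_ground //.
rewrite properE subsetIl subsetI subxx /=; apply/negP=> sFG; apply: FG.
by apply: flat_rk_eq => //; rewrite ?flat_ground // rF rG.
Qed.

Lemma rk_le_cyclic_flat F X : rk M X <= rk M F + #|X :\: F|.
Proof.
have XU : X \subset F :|: (X :\: F) by apply/subsetP=> x xX; rewrite !inE xX andbT orbN.
apply: leq_trans (rk_mono M XU) _.
have := rk_submod M F (X :\: F) => /(leq_trans (leq_addr _ _)) h.
by apply: leq_trans h _; rewrite leq_add2l rk_card.
Qed.

Lemma cyclic_part_cyclic A : cyclic M (cyclic_part M A).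
Proof.
apply/cyclicP=> x /bigcupP[C /andP[Cc CA] xC].
by exists C; split=> //; apply: cyclic_part_sup.
Qed.

Lemma cyclic_part_cl A x :
  A \subset ground M -> x \in A -> x \in cl M (cyclic_part M A) -> x \in cyclic_part M A.
Proof.
move=> AE xA xcl; have [//|xN] := boolP (x \in cyclic_part M A).
have PA := cyclic_partS M A.
have [C [Cc xC CU]] := circuit_through (subset_trans PA AE) xcl xN.
have CA : C \subset A by rewrite (subset_trans CU) // subUset sub1set xA.
case/negP: xN; exact: (subsetP (cyclic_part_sup Cc CA)).
Qed.

Lemma cyclic_part_flat F : flat M F -> flat M (cyclic_part M F).
Proof.
move=> fF; have FE := flat_ground fF; have PF := cyclic_partS M F.
have PE := subset_trans PF FE.
rewrite /flat PE eqEsubset cl_sub // andbT; apply/subsetP=> x xcl.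
exact: cyclic_part_cl (subsetP (cl_min fF PF) x xcl) xcl.
Qed.

Lemma cl_cyclic A : A \subset ground M -> cyclic M A -> cyclic M (cl M A).
Proof.
move=> AE /cyclicP Ac; apply/cyclicP=> x xcl; have Acl := cl_sub AE.
have [/Ac[C [Cc xC CA]]|xN] := boolP (x \in A).
  by exists C; split=> //; apply: subset_trans Acl.
have [C [Cc xC CU]] := circuit_through AE xcl xN; exists C; split=> //.
by rewrite (subset_trans CU) // subUset sub1set xcl.
Qed.

(* With [rk_le_cyclic_flat]: r(X) = min (r(F) + |X - F|) over cyclic flats F.
   The minimum is attained at the closure of the union of circuits inside X,
   as the other elements of X are coloops of the restriction to X. *)
Lemma rk_cyclic_flat X : X \subset ground M ->
  exists F : cyclic_flat M, rk M F + #|X :\: F| <= rk M X.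
Proof.
move=> XE; set K := cyclic_part M X; have KX : K \subset X := cyclic_partS M X.
have KE := subset_trans KX XE.
have FP : flat M (cl M K) && cyclic M (cl M K).
  by rewrite cl_flat // cl_cyclic // cyclic_part_cyclic.
exists (CyclicFlat FP); rewrite /= rk_cl //.
apply: leq_trans (_ : rk M K + #|X :\: K| <= _).
  by rewrite leq_add2l subset_leq_card // setDS // cl_sub.
suff h (n : nat) (Y : {set T}) :
    K \subset Y -> Y \subset X -> #|Y :\: K| = n -> rk M K + n <= rk M Y.
  exact: h.
elim: n Y => [|n IHn] Y KY YX Yn; first by rewrite addn0 rk_mono.
have [x xYK] : exists x, x \in Y :\: K by apply/card_gt0P; rewrite Yn.
have /andP[xK xY] : (x \notin K) && (x \in Y) by rewrite inE in xYK.
have KYx : K \subset Y :\ x by rewrite subsetD1 KY.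
have rYx : rk M K + n <= rk M (Y :\ x).
  apply: IHn => //; first by rewrite (subset_trans (subD1set _ _)).
  apply/eqP; rewrite -eqSS -Yn (cardsD1 x (Y :\: K)) xYK eqSS; apply/eqP.
  by congr #|pred_of_set _|; apply/setP=> y; rewrite !inE; case: eqP; rewrite ?andbF.
rewrite addnS; apply: leq_ltn_trans rYx _; rewrite ltnNge; apply: contra xK => rY.
have YxE : Y :\ x \subset ground M.
  by rewrite (subset_trans (subD1set _ _)) // (subset_trans YX).
have xcl : x \in cl M (Y :\ x).
  by apply: mem_cl; rewrite ?setD1K // (subsetP XE) // (subsetP YX).
have xN : x \notin Y :\ x by rewrite !inE eqxx.
have [C [Cc xC CU]] := circuit_through YxE xcl xN.
rewrite setD1K // in CU.
exact: (subsetP (cyclic_part_sup Cc (subset_trans CU YX))).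
Qed.

Hypothesis loopM : loopless M.

Lemma rk1_loopless x : x \in ground M -> rk M [set x] = 1.
Proof.
move=> /loopM; have := rk_card M [set x]; rewrite cards1.
by case: (rk M _) => [|[|]].
Qed.

Lemma rk0_loopless X : X \subset ground M -> rk M X = 0 -> X = set0.
Proof.
move=> XE rX; apply/eqP/set0Pn => -[x xX].
have : rk M [set x] <= rk M X by rewrite rk_mono ?sub1set.
by rewrite rX rk1_loopless // (subsetP XE).
Qed.

Lemma cyclic_other A x :
  cyclic M A -> x \in A -> exists2 y, y \in A & y != x.
Proof.
move=> /cyclicP Ac /Ac[C [/minsetP[/andP[CE dC] _] xC CA]].
have [C1|] := boolP (C \subset [set x]); last first.
  by case/subsetPn=> y yC; rewrite inE => yx; exists y => //; apply: (subsetP CA).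
have eC : C = [set x] by apply/eqP; rewrite eqEsubset C1 sub1set.
by move: dC; rewrite eC cards1 rk1_loopless // (subsetP CE).
Qed.

(** Without loops, any two distinct elements of [K] are parallel and form a circuit. *)
Lemma rk1_flat_cyclic K : flat M K -> rk M K <= 1 -> 1 < #|K| -> cyclic M K.
Proof.
move=> fK rK cK; have KE := flat_ground fK; apply/cyclicP=> x xK.
have /set0Pn[y] : K :\ x != set0 by rewrite -card_gt0 -ltnS; move: cK; rewrite (cardsD1 x) xK.
rewrite !inE => /andP[yx yK]; have xcl : x \in cl M [set y].
  apply: mem_cl; first exact: (subsetP KE).
  rewrite (rk1_loopless (subsetP KE y yK)); apply: leq_trans rK.
  by rewrite rk_mono // subUset !sub1set xK.
have [||C [Cc xC CU]] := circuit_through _ xcl; last exists C.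
- by rewrite sub1set (subsetP KE).
- by rewrite inE eq_sym.
by split=> //; apply: subset_trans CU _; rewrite subUset !sub1set xK.
Qed.

End MatroidFacts.

(** * Colour-preserving bijections, and pencils of sets through a point *)

Lemma colour_bijection (T U : finType) (C : eqType) (A : {set T}) (B : {set U})
    (c : T -> C) (d : U -> C) (y0 : U) :
    (forall k, #|[set x in A | c x == k]| = #|[set y in B | d y == k]|) ->
  exists f : T -> U, [/\ {in A &, injective f}, {in A, forall x, f x \in B}
    & {in A, forall x, d (f x) = c x}].
Proof.
move=> eqAB; pose sA k := enum [set x in A | c x == k].
pose sB k := enum [set y in B | d y == k].
have sz k : size (sA k) = size (sB k) by rewrite -!cardE.
(* Same position in the class of the same colour. The default [y0] is never reached for [x] in [A],
   since the classes have equal size. *)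
pose f x := nth y0 (sB (c x)) (index x (sA (c x))).
have xs x : x \in A -> index x (sA (c x)) < size (sB (c x)).
  by move=> xA; rewrite -sz index_mem mem_enum inE xA eqxx.
have fs x : x \in A -> f x \in sB (c x) by move=> /xs; apply: mem_nth.
have fB x : x \in A -> (f x \in B) && (d (f x) == c x).
  by move=> /fs; rewrite mem_enum inE.
have fc x : x \in A -> d (f x) = c x by move=> /fB/andP[_ /eqP].
exists f; split=> [x x' xA x'A eqf|x /fB/andP[]|] //.
have eqc : c x = c x' by rewrite -!fc // eqf.
move/eqP: eqf; rewrite /f -eqc nth_uniq ?enum_uniq ?xs //; last first.
  by rewrite [in sA _]eqc eqc xs.
by move/eqP; apply: (index_inj x); rewrite /sA mem_enum inE ?eqc eqxx ?xA ?x'A.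
Qed.

Lemma card_disjoint_bigcup (T I : finType) (J : {set I}) (F : I -> {set T}) :
    (forall i j x, i \in J -> j \in J -> x \in F i -> x \in F j -> i = j) ->
  #|\bigcup_(i in J) F i| = \sum_(i in J) #|F i|.
Proof.
move=> FF.
(* Indices outside [J] get the empty set, so that disjointness holds over all of [I], as
   [partition_disjoint_bigcup] asks. *)
have -> : \bigcup_(i in J) F i = \bigcup_i (if i \in J then F i else set0).
  exact: big_mkcond.
rewrite -sum1_card partition_disjoint_bigcup => [|i j ij].
  rewrite [RHS]big_mkcond; apply: eq_bigr => i _.
  by case: ifP => _; rewrite sum1_card // cards0.
rewrite -setI_eq0; apply/set0Pn=> -[x].
case: ifP => iJ; case: ifP => jJ; rewrite !inE ?andbF //.
by case/andP=> xi xj; rewrite (FF i j x) ?eqxx in ij.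
Qed.

Section Pencil.
Variables (T I : finType) (E : {set T}) (a : T) (J : {set I}) (A : I -> {set T}).
Variable W : {set T}.
Hypotheses (aE : a \in E) (AE : forall i, i \in J -> A i \subset E).
Hypothesis aA : forall i, i \in J -> a \in A i.
Hypothesis AA : forall i j y,
  i \in J -> j \in J -> y \in A i -> y \in A j -> y != a -> i = j.
Hypothesis cover : forall y, y \in E -> y != a -> exists2 i, i \in J & y \in A i.
Hypothesis aW : a \notin W.

(** The member of the pencil through [y] (none for the centre [a]), paired with membership in [W]: a
    bijection preserving this colour respects the centre, the pencil and [W] at once. *)
Definition pencil_colour y : option I * bool :=
  (if y == a then None else [pick i in J | y \in A i], y \in W).

Lemma pencil_pick i y : i \in J -> y \in A i -> y != a ->
  [pick j in J | y \in A j] = Some i.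
Proof.
move=> iJ yi ya; case: pickP => [j /andP[jJ yj]|/(_ i)]; last by rewrite iJ yi.
by rewrite (AA jJ iJ yj yi ya).
Qed.

(** Off the centre, each element of [E] lies in exactly one [A i]. The [.-1] discounts [a], which is
    in [A i] and outside [W] but has colour [(None, false)]. Only numbers that can be compared
    between two matroids remain. *)
Lemma pencil_class k :
  #|[set y in E | pencil_colour y == k]| =
    match k with
    | (None, b) => nat_of_bool (~~ b)
    | (Some i, b) =>
        if i \in J then
          if b then #|W :&: A i| else (#|A i| - #|W :&: A i|).-1
        else 0
    end.
Proof.
have colN y : y \in E -> y != a ->
    exists i, [/\ i \in J, y \in A i & pencil_colour y = (Some i, y \in W)].
  move=> yE ya; have [i iJ yi] := cover yE ya; exists i; split=> //.
  by rewrite /pencil_colour (negPf ya) (pencil_pick iJ yi).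
have cola : pencil_colour a = (None, false) by rewrite /pencil_colour eqxx (negPf aW).
case: k => [[i|] b]; last first.
  case: b; last first.
    rewrite -[RHS](cards1 a); congr #|pred_of_set _|; apply/setP=> y; rewrite !inE.
    have [->|ya] := eqVneq y a; first by rewrite aE cola eqxx.
    apply/negP=> /andP[yE]; have [j [_ _ ->]] := colN y yE ya.
    by [].
  apply/eqP; rewrite cards_eq0; apply/eqP/setP=> y; rewrite !inE.
  have [->|ya] := eqVneq y a; first by rewrite cola andbF.
  by apply/negP=> /andP[yE]; have [j [_ _ ->]] := colN y yE ya.
have [iJ|iJ] := ifPn; last first.
  apply/eqP; rewrite cards_eq0; apply/eqP/setP=> y; rewrite !inE.
  have [->|ya] := eqVneq y a; first by rewrite cola andbF.
  apply/negP=> /andP[yE]; have [j [jJ _ ->]] := colN y yE ya.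
  by case/eqP=> eji _; rewrite -eji jJ in iJ.
have -> : [set y in E | pencil_colour y == (Some i, b)] =
          [set y in A i | (y != a) && ((y \in W) == b)].
  apply/setP=> y; rewrite !inE; have [->|ya] := eqVneq y a.
    by rewrite cola /= !andbF.
  rewrite /=; apply/andP/andP=> [[yE]|[yi /eqP <-]].
    have [j [jJ yj ->]] := colN y yE ya.
    by case/eqP=> <- <-; split; rewrite ?eqxx.
  split; first exact: (subsetP (AE iJ)).
  by rewrite /pencil_colour (negPf ya) (pencil_pick iJ yi).
case: b.
  congr #|pred_of_set _|; apply/setP=> y; rewrite !inE andbC eqb_id.
  by have [->|] := eqVneq y a; rewrite // (negPf aW).
rewrite setIC -cardsD (cardsD1 a (A i :\: W)) !inE aW aA //=.
by congr #|pred_of_set _|; apply/setP=> y; rewrite !inE eqbF_neg andbC -andbA.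
Qed.

Lemma pencil_card (X : {set T}) : X \subset E -> a \notin X ->
  #|X| = \sum_(i in J) #|X :&: A i|.
Proof.
move=> XE aX.
have {1}-> : X = \bigcup_(i in J) (X :&: A i).
  apply/setP=> y; apply/idP/bigcupP => [yX|[i _ /setIP[]//]].
  have ya : y != a by apply: contraNneq aX => <-.
  by have [i iJ yi] := cover (subsetP XE y yX) ya; exists i => //; rewrite inE yX.
apply: card_disjoint_bigcup => i j y iJ jJ /setIP[yX yi] /setIP[_ yj].
by apply: AA yi yj _ => //; apply: contraNneq aX => <-.
Qed.

End Pencil.

(** * Matroids with the configuration of a cone *)

Section CyclicFlats.
Variables (T : finType) (M : matroid T).
Implicit Types F G : cyclic_flat M.

Lemma cf_flat F : flat M F.
Proof. by have /andP[] := cf_setP F. Qed.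

Lemma cf_cyclic F : cyclic M F.
Proof. by have /andP[] := cf_setP F. Qed.

Lemma cf_ground F : F \subset ground M.
Proof. exact/flat_ground/cf_flat. Qed.

Lemma cf_exists (A : {set T}) : flat M A -> cyclic M A ->
  exists F : cyclic_flat M, F = A :> {set T}.
Proof.
move=> fA cA; have AP : flat M A && cyclic M A by rewrite fA.
by exists (CyclicFlat AP).
Qed.

Lemma cf_setU_join F G : F :|: G \subset (F `|` G)%O.
Proof. by rewrite cl_sub // subUset !cf_ground. Qed.

Lemma rk_join F G : rk M (F `|` G)%O = rk M (F :|: G).
Proof. by rewrite rk_cl // subUset !cf_ground. Qed.

End CyclicFlats.

Section TippedMatroid.
Variables (T : finType) (Q : matroid T) (a : T) (Gmax : cyclic_flat Q).
(* Q stands for the free cone with tip a, and Gmax for its largest cyclic flat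
   avoiding a. *)
Hypotheses (loopQ : loopless Q) (aE : a \in ground Q).
Hypothesis rk_tip2 : forall y, y \in ground Q -> y != a -> rk Q [set a; y] = 2.
Hypothesis tip_line : forall y,
  y \in ground Q -> y != a -> cyclic Q (cl Q [set a; y]).
Hypothesis GmaxN : a \notin Gmax.
Hypothesis Gmax_sup : forall G : cyclic_flat Q, a \notin G -> G \subset Gmax.
Hypothesis skew : forall G L : cyclic_flat Q, a \notin G -> a \in L ->
  rk Q L = 2 -> G :&: L = set0 -> rk Q G + 2 <= rk Q (G :|: L).
Hypothesis rkQ : 3 < rank Q.

Variables (U : finType) (N : matroid U) (Phi : cyclic_flat Q -> cyclic_flat N).
Implicit Types F G L P : cyclic_flat Q.

Hypothesis card_ground : #|ground Q| = #|ground N|.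
Hypothesis bijPhi : bijective Phi.
Hypothesis PhiI : {morph Phi : F G / (F `&` G)%O}.
Hypothesis PhiU : {morph Phi : F G / (F `|` G)%O}.
Hypothesis card_Phi : forall F, #|Phi F| = #|F|.
Hypothesis rk_Phi : forall F, rk N (Phi F) = rk Q F.

Definition lines : {set cyclic_flat Q} := [set L | (a \in cf_set L) && (rk Q L == 2)].

Definition planes (L : cyclic_flat Q) : {set cyclic_flat Q} :=
  [set P | (L \subset cf_set P) && (rk Q P == 3)].

Lemma sub_Phi F G : (Phi F \subset Phi G) = (F \subset G).
Proof.
change ((Phi F <= Phi G)%O = (F <= G)%O).
by rewrite !Order.MeetTheory.leEmeet -PhiI (inj_eq (bij_inj bijPhi)).
Qed.

(** A loop lies in every flat, but the image of the empty cyclic flat of [Q] has no elements. *)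
Lemma loopN : loopless N.
Proof.
have cl0 : cl Q set0 = set0.
  apply/setP=> x; rewrite !inE setU0; apply/negP=> /andP[xE].
  rewrite rk1_loopless // => /eqP r1.
  by have := rk_card Q set0; rewrite -r1 cards0.
have [||F F0] := @cf_exists _ Q set0; first by rewrite /flat sub0set cl0 eqxx.
  by apply/cyclicP=> x; rewrite inE.
move=> x xE; apply/eqP=> rx.
suff : x \in cf_set (Phi F).
  have /eqP := card_Phi F; rewrite F0 cards0 cards_eq0 => /eqP ->.
  by rewrite inE.
have /andP[_ /eqP <-] := cf_flat (Phi F); apply: mem_cl => //.
have := rk_submod N [set x] (Phi F); rewrite rx add0n.
exact: leq_trans (leq_addr _ _).
Qed.

Lemma Phi_surj H : exists F, Phi F = H.
Proof. by case: bijPhi => g _ gK; exists (g H). Qed.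

(** Pulls intersections of flats of [N] back to [Q]: such a [K] is cyclic, hence in the range of
    [Phi]. *)
Lemma rk1_Phi K : flat N K -> rk N K <= 1 -> 1 < #|K| ->
  exists J, Phi J = K :> {set U}.
Proof.
move=> fK rK cK; have [H HK] := cf_exists fK (rk1_flat_cyclic loopN fK rK cK).
by have [J JH] := Phi_surj H; exists J; rewrite JH.
Qed.

(** * Lines and planes through the tip, and their images *)

Lemma tip_sub L : L \in lines -> a \in cf_set L.
Proof. by rewrite inE => /andP[]. Qed.

Lemma line_rk L : L \in lines -> rk Q L = 2.
Proof. by rewrite inE => /andP[_ /eqP]. Qed.

Lemma line_other L : L \in lines -> exists2 y, y \in cf_set L & y != a.
Proof. by move/tip_sub; apply/(cyclic_other loopQ)/cf_cyclic. Qed.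

Lemma tip2_ground y : y \in ground Q -> [set a; y] \subset ground Q.
Proof. by move=> yE; rewrite subUset !sub1set aE. Qed.

Lemma line_through y : y \in ground Q -> y != a ->
  exists2 L, L \in lines & y \in cf_set L.
Proof.
move=> yE ya; have sE := tip2_ground yE.
have [L LE] := cf_exists (cl_flat sE) (tip_line yE ya).
exists L; last by rewrite LE (subsetP (cl_sub sE)) // !inE eqxx orbT.
by rewrite inE LE rk_cl // rk_tip2 // (subsetP (cl_sub sE)) // !inE eqxx.
Qed.

Lemma lineE L y : L \in lines -> y \in cf_set L -> y != a ->
  cf_set L = cl Q [set a; y].
Proof.
move=> lL yL ya; have yE := subsetP (cf_ground L) y yL; have sE := tip2_ground yE.
apply/esym/(@flat_rk_eq _ Q); rewrite ?cl_flat ?cf_ground // ?rk_cl ?rk_tip2 ?line_rk //.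
by rewrite cl_min ?cf_flat // subUset !sub1set yL tip_sub.
Qed.

Lemma line_inj L L' y : L \in lines -> L' \in lines ->
  y \in cf_set L -> y \in cf_set L' -> y != a -> L = L'.
Proof.
by move=> lL lL' yL yL' ya; apply: val_inj; rewrite /= (lineE lL yL) ?(lineE lL' yL').
Qed.

Lemma line_sub L y (P : {set T}) : L \in lines -> y \in cf_set L -> y != a ->
  flat Q P -> a \in P -> y \in P -> L \subset P.
Proof.
by move=> lL yL ya fP aP yP; rewrite (lineE lL yL ya) cl_min // subUset !sub1set aP.
Qed.

Lemma line_sub_eq L L' : L \in lines -> L' \in lines -> L \subset L' -> L = L'.
Proof.
move=> lL lL' LL'; have [y yL ya] := line_other lL.
exact: line_inj lL lL' yL (subsetP LL' y yL) ya.
Qed.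

(** With [y] on [L'] off [L], the closure of [y |: L] contains [a] and [y], hence all of [L'], so
    the join has the rank of [y |: L]. *)
Lemma join_plane L L' : L \in lines -> L' \in lines -> L <> L' ->
  (L `|` L')%O \in planes L.
Proof.
move=> lL lL' LL'; rewrite inE; have /subUsetP[-> _] /= := cf_setU_join L L'.
rewrite rk_join; have [y yL' ya] := line_other lL'.
have yL : y \notin cf_set L by apply/negP=> yL; case: LL'; apply: line_inj lL lL' yL yL' ya.
have yE := subsetP (cf_ground L') y yL'.
have r3 : rk Q (y |: L) = 3 by rewrite rk_notin_flat ?cf_flat // line_rk.
have sE : y |: L \subset ground Q by rewrite subUset sub1set yE cf_ground.
rewrite eqn_leq -{2}r3 rk_mono ?andbT; last first.
  by rewrite subUset sub1set inE yL' orbT subsetUl.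
rewrite -r3 -(rk_cl sE) rk_mono // subUset (subset_trans _ (cl_sub sE)) ?subsetUr //=.
have sub := subsetP (cl_sub sE).
by apply: (line_sub lL' yL' ya); rewrite ?cl_flat ?sub // !inE ?eqxx ?tip_sub ?orbT.
Qed.

Lemma plane_sub L P : P \in planes L -> L \subset P.
Proof. by rewrite inE => /andP[]. Qed.

Lemma plane_rk L P : P \in planes L -> rk Q P = 3.
Proof. by rewrite inE => /andP[_ /eqP]. Qed.

Lemma plane_inj L P P' x : L \in lines -> P \in planes L -> P' \in planes L ->
  x \in cf_set P -> x \in cf_set P' -> x \notin cf_set L -> P = P'.
Proof.
move=> lL pP pP' xP xP' xL; apply/eqP; apply: contraNT xL => /eqP PP'.
rewrite -(@flat_cover_meet _ Q L P P') ?cf_flat ?plane_sub // ?inE ?xP //.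
- by rewrite (plane_rk pP) line_rk.
- by rewrite (plane_rk pP') line_rk.
by move/val_inj.
Qed.

(** [flat_cover_meet] asks only for inclusions and ranks, and [Phi] preserves both. *)
Lemma Phi_plane_inj L P P' x : L \in lines -> P \in planes L -> P' \in planes L ->
  x \in cf_set (Phi P) -> x \in cf_set (Phi P') -> x \notin cf_set (Phi L) -> P = P'.
Proof.
move=> lL pP pP' xP xP' xL; apply/eqP; apply: contraNT xL => /eqP PP'.
rewrite -(@flat_cover_meet _ N (Phi L) (Phi P) (Phi P')) ?cf_flat ?inE ?xP //.
- by rewrite sub_Phi plane_sub.
- by rewrite sub_Phi plane_sub.
- by rewrite !rk_Phi (plane_rk pP) line_rk.
- by rewrite !rk_Phi (plane_rk pP') line_rk.
by move/val_inj/(bij_inj bijPhi).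
Qed.

(** Two common points would make the intersection a cyclic flat, hence some [Phi J] with [J] inside
    both lines. As [J] has at least two elements, one of them differs from the tip and determines
    the line. *)
Lemma Phi_line_meet L L' x y : L \in lines -> L' \in lines -> L <> L' ->
  x \in cf_set (Phi L) -> x \in cf_set (Phi L') ->
  y \in cf_set (Phi L) -> y \in cf_set (Phi L') -> x = y.
Proof.
move=> lL lL' LL' xL xL' yL yL'; apply/eqP; apply: contra_notT LL' => xy.
set K := Phi L :&: Phi L'; have fK : flat N K by rewrite flatI ?cf_flat.
have [KL|nKL] := boolP (Phi L \subset K).
  by apply: line_sub_eq => //; rewrite -sub_Phi (subset_trans KL) ?subsetIr.
have rK : rk N K <= 1.
  rewrite -ltnS -(line_rk lL) -rk_Phi (@flat_rk_lt _ N) ?cf_ground //.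
  by rewrite properE subsetIl.
have cK : 1 < #|K|.
  by apply/card_gt1P; exists x, y; rewrite !inE xL xL' yL yL'.
have [J JK] := rk1_Phi fK rK cK.
have JL : J \subset L by rewrite -sub_Phi JK subsetIl.
have JL' : J \subset L' by rewrite -sub_Phi JK subsetIr.
rewrite -JK card_Phi in cK; have /card_gt1P[u [v [uJ vJ uv]]] := cK.
have [ua|ua] := eqVneq u a; last first.
  exact: line_inj lL lL' (subsetP JL u uJ) (subsetP JL' u uJ) ua.
have va : v != a by rewrite -ua eq_sym.
exact: line_inj lL lL' (subsetP JL v vJ) (subsetP JL' v vJ) va.
Qed.

(* This is where rank at least 4 is used: a line off the plane of L1 and L3. *)
Lemma Phi_lines_concurrent L1 L3 x : L1 \in lines -> L3 \in lines -> L1 <> L3 ->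
  x \in cf_set (Phi L1) -> x \in cf_set (Phi L3) ->
  forall L, L \in lines -> x \in cf_set (Phi L).
Proof.
move=> l1 l3 L13 x1 x3; set P13 := (L1 `|` L3)%O.
have mono (F G : cyclic_flat Q) : F \subset G -> x \in cf_set (Phi F) -> x \in cf_set (Phi G).
  by move=> FG; apply: subsetP; rewrite sub_Phi.
(* The images of the planes spanned by [L] with [L'] and by [L] with [L''] share [x], a point
   outside [Phi L]. So these planes coincide, and they equal the plane of [L'] and [L'']. *)
have off (L L' L'' : cyclic_flat Q) : L \in lines -> L' \in lines -> L'' \in lines ->
    x \in cf_set (Phi L') -> x \in cf_set (Phi L'') -> x \notin cf_set (Phi L) ->
    L' <> L'' -> L \subset (L' `|` L'')%O.
  move=> l l' l'' xL' xL'' xL LL.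
  have ne (K : cyclic_flat Q) : x \in cf_set (Phi K) -> L <> K by move=> xK LK; rewrite LK xK in xL.
  have p' := join_plane l l' (ne _ xL'); have p'' := join_plane l l'' (ne _ xL'').
  have /subUsetP[LP' L'P'] := cf_setU_join L L'.
  have /subUsetP[_ L''P''] := cf_setU_join L L''.
  have PP := Phi_plane_inj l p' p'' (mono _ _ L'P' xL') (mono _ _ L''P'' xL'') xL.
  suff -> : cf_set (L' `|` L'')%O = (L `|` L')%O by [].
  apply: (@flat_rk_eq _ Q); rewrite ?cf_flat ?cf_ground //.
    by rewrite cl_min ?cf_flat // subUset L'P' PP.
  by rewrite (plane_rk p') (plane_rk (join_plane l' l'' LL)).
have [y yE yP] : exists2 y, y \in ground Q & y \notin cf_set P13.
  apply/subsetPn; apply: contraTN rkQ => QP; rewrite -leqNgt /rank.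
  by rewrite -(plane_rk (join_plane l1 l3 L13)) rk_mono.
have P1 := plane_sub (join_plane l1 l3 L13).
have ya : y != a by apply: contraNneq yP => ->; rewrite (subsetP P1) ?tip_sub.
have [L5 l5 y5] := line_through yE ya.
have nL5 : ~~ (L5 \subset P13) by apply: contra yP => /subsetP; apply.
(* If [x] were off [Phi L5], then [off] would put [L5] inside [P13]. *)
have x5 : x \in cf_set (Phi L5).
  by apply: contraNT nL5 => x5; apply: off.
(* If [Phi L] missed [x], then [L] would lie in the plane of [L1] and [L3] and in that of [L1] and
   [L5]. A point of [L] off [L1] identifies these planes, although [L5] is not in [P13]. *)
move=> L l; apply: contraT => xL.
have L15 : L1 <> L5 by move=> e; rewrite -e P1 in nL5.
have sub3 := off _ _ _ l l1 l3 x1 x3 xL L13; have sub5 := off _ _ _ l l1 l5 x1 x5 xL L15.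
have [u uL ua] := line_other l.
have u1 : u \notin cf_set L1.
  by apply: contraNN xL => u1; rewrite (line_inj l l1 uL u1 ua).
have e : P13 = (L1 `|` L5)%O.
  by apply: (plane_inj l1 _ _ _ _ u1); rewrite ?join_plane ?(subsetP sub3) ?(subsetP sub5).
have /subUsetP[_] := cf_setU_join L1 L5.
by rewrite -e (negPf nL5).
Qed.

Lemma two_lines : exists L L', [/\ L \in lines, L' \in lines & L <> L'].
Proof.
have out (F : cyclic_flat Q) : rk Q F < 4 -> exists2 y, y \in ground Q & y \notin cf_set F.
  move=> rF; apply/subsetPn; apply: contraL rF => QF.
  by rewrite -leqNgt (leq_trans rkQ) ?rk_mono.
have [y yE yG] : exists2 y, y \in ground Q & y != a.
  have /subsetPn[y yE] : ~~ (ground Q \subset [set a]); last by rewrite inE; exists y.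
  apply: contraL rkQ => sQ; rewrite -leqNgt (leq_trans (rk_mono Q sQ)) //.
  by rewrite (leq_trans (rk_card _ _)) ?cards1.
have [L l yL] := line_through yE yG.
have [|z zE zL] := out L; first by rewrite line_rk.
have za : z != a by apply: contraNneq zL => ->; apply: tip_sub.
have [L' l' zL'] := line_through zE za.
by exists L, L'; split=> // e; rewrite e zL' in zL.
Qed.

Lemma card_lines : #|ground Q :\ a| = \sum_(L in lines) #|L :\ a|.
Proof.
rewrite -card_disjoint_bigcup => [|L L' y l l' /setD1P[ya yL] /setD1P[_ yL']].
  congr #|pred_of_set _|; apply/setP=> y; apply/idP/bigcupP.
    by case/setD1P=> ya yE; have [L l yL] := line_through yE ya; exists L => //; rewrite !inE ya.
  by case=> L _ /setD1P[ya yL]; rewrite !inE ya (subsetP (cf_ground L)).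
exact: line_inj yL yL' ya.
Qed.

Lemma Phi_tip : exists2 b, b \in ground N & forall L, L \in lines -> b \in cf_set (Phi L).
Proof.
have [/existsP[L /existsP[L' /and4P[l l' /eqP LL' /set0Pn[x]]]]|none] :=
  boolP [exists L, [exists L', [&& L \in lines, L' \in lines, L != L'
                                 & Phi L :&: Phi L' != set0]]].
  rewrite inE => /andP[xL xL']; exists x; first exact: (subsetP (cf_ground _) _ xL).
  exact: Phi_lines_concurrent LL' xL xL'.
(* Pairwise disjoint lines would contain too many points. *)
suff : 1 < #|ground Q| - #|ground Q :\ a|.
  by rewrite (cardsD1 a (ground Q)) aE addnK.
(* Each [Phi L] has one point more than [L :\ a], so disjointness costs an extra point for each of
   at least two lines, whereas [ground N] has just one point more than [ground Q :\ a]. *)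
have cN : \sum_(L in lines) #|L :\ a| + #|lines| <= #|ground N|.
  have -> : \sum_(L in lines) #|L :\ a| + #|lines| = \sum_(L in lines) #|Phi L|.
    rewrite -sum1_card -big_split; apply: eq_bigr => L l /=.
    by rewrite card_Phi (cardsD1 a L) tip_sub // addnC.
  rewrite -card_disjoint_bigcup => [|L L' y l l' yL yL'].
    by apply/subset_leq_card/bigcupsP=> L _; apply: cf_ground.
  apply/eqP; apply: contraNT none => LL'; apply/existsP; exists L; apply/existsP; exists L'.
  by rewrite l l' LL'; apply/set0Pn; exists y; rewrite inE yL.
have [L [L' [l l' /eqP LL']]] := two_lines.
rewrite card_ground card_lines ltn_subRL; apply: leq_trans cN.
by rewrite ltn_add2l; apply/card_gt1P; exists L, L'.
Qed.

Section PhiTip.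
Variable b : U.
Hypotheses (bE : b \in ground N) (bL : forall L, L \in lines -> b \in cf_set (Phi L)).

Lemma Phi_line_inj L L' z : L \in lines -> L' \in lines ->
  z \in cf_set (Phi L) -> z \in cf_set (Phi L') -> z != b -> L = L'.
Proof.
move=> l l' zL zL' zb; apply/eqP; apply: contraNT zb => /eqP LL'.
by apply/eqP; apply: Phi_line_meet LL' zL zL' _ _; rewrite ?bL.
Qed.

(** The sets [Phi L :\ b] are disjoint and as large as the sets [L :\ a], which partition
    [ground Q :\ a]. They fill [ground N :\ b] because the ground sets have equal size. *)
Lemma Phi_line_cover z : z \in ground N -> z != b ->
  exists2 L, L \in lines & z \in cf_set (Phi L).
Proof.
move=> zE zb; set X := \bigcup_(L in lines) (Phi L :\ b).
suff XE : X = ground N :\ b.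
  have : z \in X by rewrite XE !inE zb.
  by case/bigcupP=> L l /setD1P[_ zL]; exists L.
apply/eqP; rewrite eqEcard; apply/andP; split.
  by apply/bigcupsP=> P pP; rewrite setSD ?cf_ground.
rewrite card_disjoint_bigcup => [|L L' x l l' /setD1P[xb xL] /setD1P[_ xL']]; last first.
  exact: Phi_line_inj xL xL' xb.
apply: leq_trans (_ : \sum_(L in lines) #|L :\ a| <= _); last first.
  apply: leq_sum => L l; rewrite -(leq_add2l 1).
  have := cardsD1 a L; rewrite tip_sub // => <-.
  by have := cardsD1 b (Phi L); rewrite bL // card_Phi => <-.
rewrite -card_lines -(leq_add2l 1).
have := cardsD1 a (ground Q); rewrite aE => <-.
by have := cardsD1 b (ground N); rewrite bE card_ground => <-.
Qed.

(** * Cyclic flats avoiding the tip *)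

Lemma Phi_meet_rk G L : a \notin cf_set G -> L \in lines -> rk N (Phi G :&: Phi L) <= 1.
Proof.
move=> aG l; rewrite -ltnS -(line_rk l) -rk_Phi (@flat_rk_lt _ N) ?flatI ?cf_flat ?cf_ground //.
rewrite properE subsetIr subsetI subxx andbT sub_Phi.
by apply: contra aG => /subsetP; apply; apply: tip_sub.
Qed.

(** If the images share two or more elements, their intersection is some [Phi J] with [J] inside
    [G :&: L]. Otherwise only an empty [G :&: L] matters: then [skew] and submodularity in [N] give
    the intersection rank 0, and [N] has no loops. *)
Lemma Phi_meet_le G L : a \notin cf_set G -> L \in lines ->
  #|Phi G :&: Phi L| <= #|G :&: L|.
Proof.
move=> aG l; have fK : flat N (Phi G :&: Phi L) by rewrite flatI ?cf_flat.
have rK := Phi_meet_rk aG l.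
have [cK|cK] := ltnP 1 #|Phi G :&: Phi L|.
  have [J JK] := rk1_Phi fK rK cK.
  by rewrite -JK card_Phi subset_leq_card // subsetI -!sub_Phi JK subsetIl subsetIr.
have [GL|] := eqVneq (cf_set G :&: L) set0; last first.
  by rewrite -card_gt0; apply: leq_trans.
rewrite (rk0_loopless loopN (flat_ground fK)) ?cards0 //.
have := rk_submod N (Phi G) (Phi L).
rewrite -rk_join -PhiU !rk_Phi rk_join (line_rk l) => sub.
have := leq_trans (leq_add (skew aG (tip_sub l) (line_rk l) GL) (leqnn _)) sub.
by rewrite -[leqRHS]addn0 leq_add2l leqn0 => /eqP.
Qed.

(** If [b] were in [Phi G], the intersection of [Phi G] with some [Phi L] through a second point of
    [Phi G] would be a [Phi J] containing [b]. Any other line is disjoint from [J], yet its image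
    meets [Phi J] in [b], against [Phi_meet_le]. *)
Lemma Phi_tip_notin G : a \notin cf_set G -> b \notin cf_set (Phi G).
Proof.
move=> aG; apply/negP=> bG.
have [z zG zb] := cyclic_other loopN (cf_cyclic (Phi G)) bG.
have [L l zL] := Phi_line_cover (subsetP (cf_ground _) z zG) zb.
have fK : flat N (Phi G :&: Phi L) by rewrite flatI ?cf_flat.
have cK : 1 < #|Phi G :&: Phi L|.
  by apply/card_gt1P; exists b, z; rewrite !inE bG zG bL // eq_sym.
have [J JK] := rk1_Phi fK (Phi_meet_rk aG l) cK.
have JG : J \subset G by rewrite -sub_Phi JK subsetIl.
have JL : J \subset L by rewrite -sub_Phi JK subsetIr.
have aJ : a \notin cf_set J by apply: contra aG; apply: (subsetP JG).
have [L' l' LL'] : exists2 L', L' \in lines & L <> L'.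
  have [L1 [L2 [l1 l2 L12]]] := two_lines.
  have [e|/eqP] := eqVneq L L1; last by exists L1.
  by exists L2 => //; rewrite e.
have := Phi_meet_le aJ l'; rewrite leqNgt => /negP; apply.
have -> : cf_set J :&: L' = set0.
  apply/setP=> y; rewrite !inE; apply/negP=> /andP[yJ yL']; apply: LL'.
  apply: line_inj (subsetP JL y yJ) yL' _ => //.
  by apply: contraNneq aJ => <-.
by rewrite cards0 card_gt0; apply/set0Pn; exists b; rewrite inE JK inE bG !bL.
Qed.

Lemma Phi_meet_card G L : a \notin cf_set G -> L \in lines ->
  #|Phi G :&: Phi L| = #|G :&: L|.
Proof.
move=> aG l; have bG := Phi_tip_notin aG.
have le : forall L, L \in lines ->
    #|Phi G :&: Phi L| <= #|G :&: L| ?= iff (#|Phi G :&: Phi L| == #|G :&: L|).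
  by move=> L' l'; split=> //; apply: Phi_meet_le.
(* Both sums equal [#|G|], one of them through [#|Phi G|], so the inequality is an equality in every
   term. *)
have [_] := leqif_sum le.
rewrite -(pencil_card Phi_line_inj Phi_line_cover (cf_ground _) bG).
rewrite -(pencil_card line_inj line_through (cf_ground _) aG) card_Phi eqxx.
by move/esym/forall_inP/(_ L l)/eqP.
Qed.

(** [Gmax :&: L] has rank at most 1, so it lies in the closure of any of its elements. A cyclic flat
    avoiding the tip is therefore determined by the lines it meets. *)
Lemma Gmax_line G L : a \notin cf_set G -> L \in lines -> G :&: L != set0 ->
  Gmax :&: L \subset G.
Proof.
move=> aG l /set0Pn[z /setIP[zG zL]]; apply/subsetP=> w wK.
have fK : flat Q (Gmax :&: L) by rewrite flatI ?cf_flat.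
have rK : rk Q (Gmax :&: L) <= 1.
  rewrite -ltnS -(line_rk l) (@flat_rk_lt _ Q) ?cf_ground //.
  rewrite properE subsetIr subsetI subxx andbT.
  by apply: contra GmaxN => /subsetP; apply; apply: tip_sub.
have zE := subsetP (cf_ground G) z zG.
have : w \in cl Q [set z].
  apply: mem_cl; first exact: subsetP (flat_ground fK) w wK.
  rewrite (rk1_loopless loopQ zE); apply: leq_trans rK.
  by rewrite rk_mono // subUset !sub1set wK inE zL (subsetP (Gmax_sup aG)).
by apply: subsetP; rewrite cl_min ?cf_flat // sub1set.
Qed.

Lemma cyclic_flat_bijection : exists f : T -> U,
  [/\ {in ground Q &, injective f}, {in ground Q, forall x, f x \in ground N}
    & forall F, f @: cf_set F = Phi F].
Proof.
have bG := Phi_tip_notin GmaxN.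
pose c := pencil_colour a lines (@cf_set T Q) Gmax.
pose d := pencil_colour b lines (fun L => cf_set (Phi L)) (Phi Gmax).
have [k|f [fI fN fc]] := @colour_bijection _ _ _ (ground Q) (ground N) c d b.
  rewrite (pencil_class aE (fun L _ => cf_ground L) tip_sub line_inj line_through GmaxN).
  rewrite (pencil_class bE (fun L _ => cf_ground (Phi L)) bL Phi_line_inj Phi_line_cover bG).
  case: k => [[L|] bb] //; case: ifP => // l.
  by rewrite Phi_meet_card // card_Phi.
exists f; split=> // F.
(* Every point of [N] other than [b] has a line in its colour, while the colour of [a] has none. *)
have fa : f a = b.
  apply/eqP; apply: contraT => fab.
  have [L l faL] := Phi_line_cover (fN a aE) fab.
  have := fc a aE; rewrite /d /c /pencil_colour eqxx (negPf fab).
  by rewrite (pencil_pick Phi_line_inj l faL fab).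
have fL L y : L \in lines -> y \in cf_set L -> y != a ->
    f y \in cf_set (Phi L) /\ (f y \in cf_set (Phi Gmax)) = (y \in cf_set Gmax).
  move=> l yL ya; have := fc y (subsetP (cf_ground L) y yL).
  rewrite /d /c /pencil_colour (negPf ya) (pencil_pick line_inj l yL ya) => -[].
  by case: eqP => // _; case: pickP => // L' /andP[_ fyL'] [<-] ->.
(* [f] is injective and [Phi] keeps sizes, so one inclusion is enough. *)
apply/eqP; rewrite eqEcard card_Phi card_in_imset ?leqnn ?andbT; last first.
  by apply: sub_in2 fI; apply/subsetP/cf_ground.
apply/subsetP=> _ /imsetP[y yF ->]; have yE := subsetP (cf_ground F) y yF.
have [aF|aF] := boolP (a \in cf_set F).
  have sub L z : L \in lines -> z \in cf_set L -> z != a -> z \in cf_set F ->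
      Phi L \subset Phi F.
    by move=> l zL za zF; rewrite sub_Phi (line_sub l zL za) ?cf_flat.
  have [->|ya] := eqVneq y a.
    have [z zF za] := cyclic_other loopQ (cf_cyclic F) aF.
    have [L l zL] := line_through (subsetP (cf_ground F) z zF) za.
    by rewrite fa (subsetP (sub L z l zL za zF)) ?bL.
  have [L l yL] := line_through yE ya.
  by rewrite (subsetP (sub L y l yL ya yF)) //; have [] := fL L y l yL ya.
have ya : y != a by apply: contraNneq aF => <-.
have [L l yL] := line_through yE ya; have [fyL fyG] := fL L y l yL ya.
have FG := Gmax_sup aF; have yG := subsetP FG y yF.
(* As [F] meets [L], it has the same trace on [L] as [Gmax], and [Phi_meet_card] carries this over
   to the images. The colour already puts [f y] in [Phi Gmax]. *)
have e : Phi F :&: Phi L = Phi Gmax :&: Phi L.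
  apply/eqP; rewrite eqEcard setSI ?sub_Phi //= !Phi_meet_card //.
  rewrite subset_leq_card // subsetI subsetIr Gmax_line //.
  by apply/set0Pn; exists y; rewrite inE yF.
by have : f y \in Phi F :&: Phi L; [rewrite e inE fyG yG | rewrite inE => /andP[]].
Qed.

End PhiTip.

(** The rank of a set is the minimum, over cyclic flats, of the rank of the flat plus the number of
    elements of the set outside it, and by [fD] the map [f] matches these terms. Each inequality
    takes a minimising flat on one side and the general bound on the other. *)
Lemma tipped_isomorphic : isomorphic Q N.
Proof.
have [b bE bL] := Phi_tip; have [f [fI fN fF]] := cyclic_flat_bijection bE bL.
pose g (x : {x | x \in ground Q}) : {y | y \in ground N} := Sub (f (val x)) (fN _ (valP x)).
have gI : injective g.
  by move=> x y [/fI e]; apply/val_inj/e; apply: valP.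
exists g; first by apply: inj_card_bij gI _; rewrite !card_sig -card_ground.
move=> A; have -> : val @: (g @: A) = f @: (val @: A).
  by rewrite -!imset_comp; apply: eq_imset => x.
set X := val @: A; have XE : X \subset ground Q.
  by apply/subsetP=> _ /imsetP[x _ ->]; apply: valP.
have fD (F : cyclic_flat Q) : (f @: X) :\: Phi F = f @: (X :\: F).
  rewrite -fF; apply/setP=> z; apply/setDP/imsetP => [[/imsetP[x xX ->] xF]|[x /setDP[xX xF] ->]].
    by exists x => //; rewrite inE xX andbT; apply: contra xF; apply: imset_f.
  split; first exact: imset_f.
  apply: contra xF => /imsetP[y yF /fI ->] //; first exact: (subsetP XE).
  exact: (subsetP (cf_ground F)).
apply/eqP; rewrite eqn_leq; apply/andP; split.
  have [F rF] := rk_cyclic_flat XE; apply: leq_trans rF.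
  apply: leq_trans (rk_le_cyclic_flat _ (Phi F) _) _.
  by rewrite rk_Phi leq_add2l fD leq_imset_card.
have fXE : f @: X \subset ground N.
  by apply/subsetP=> _ /imsetP[x /(subsetP XE) xE ->]; exact: (fN x xE).
have [H rH] := rk_cyclic_flat fXE; have [F FH] := Phi_surj H.
apply: leq_trans rH; apply: leq_trans (rk_le_cyclic_flat _ F _) _.
rewrite -FH rk_Phi leq_add2l fD card_in_imset //.
by apply: sub_in2 fI => x /setDP[/(subsetP XE)].
Qed.

End TippedMatroid.

(** * The free cone *)

(** The trace of adding [y] freely to a flat through [t] that persists under later principal
    extensions: spanning [y] without using it requires spanning [t]. *)
Definition freely_on (T : finType) (N : matroid T) (t y : T) : Prop :=
  forall A : {set T}, y \notin A -> rk N (y |: A) = rk N A -> rk N (t |: A) = rk N A.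

Lemma principal_ext_free_new (T : finType) (N : matroid T) (e t : T) (X : {set T}) :
  t \in X -> t != e -> freely_on (principal_ext N e X) t e.
Proof.
move=> tX te A eA; rewrite principal_ext_rkU1 // !principal_ext_rk //; last first.
  by rewrite !inE negb_or eq_sym te.
case: ifP => [/subsetP/(_ t tX)|_ /eqP]; first by rewrite inE => /andP[_ /eqP].
by rewrite -[X in _ == X]addn0 -addn1 eqn_add2l.
Qed.

Lemma principal_ext_free_old (T : finType) (N : matroid T) (e t y : T) (X : {set T}) :
    t \in X -> t != e -> y != e -> freely_on N t y ->
  freely_on (principal_ext N e X) t y.
Proof.
move=> tX te ye fy A yA.
have notinU z (C : {set T}) : z != e -> e \notin C -> e \notin z |: C.
  by move=> ze eC; rewrite !inE negb_or eq_sym ze.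
have [eA|eA] := boolP (e \in A); last first.
  by rewrite !principal_ext_rk ?notinU //; apply: fy.
have absorb B : X \subset cl N B -> rk N (t |: B) = rk N B.
  by move/subsetP/(_ t tX); rewrite inE => /andP[_ /eqP].
pose B := A :\ e; have eB : e \notin B by rewrite !inE eqxx.
have AE : A = e |: B by rewrite setD1K.
have yB : y \notin B by rewrite !inE negb_and yA orbT.
move=> h; apply/eqP; rewrite eqn_leq (rk_mono _ (subsetUr _ _)) andbT.
move: h; rewrite AE !(setUCA _ [set e]) !principal_ext_rkU1 ?notinU //.
have [XB _|XB] := boolP (X \subset cl N B).
  by rewrite (subset_trans XB (cl_mono N (subsetUr _ _))) absorb.
(* If [y |: B] spans [X], it spans [t] and has rank one above [B], which bounds the rank of
   [e |: (t |: B)]. If not, the hypothesis descends to [B] in [N]. *)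
have [XyB ry|_ [/(fy _ yB) ->]] := boolP (X \subset cl N (y |: B)); last by case: ifP.
have -> : (if X \subset cl N (t |: B) then rk N (t |: B) else (rk N (t |: B)).+1) =
          rk (principal_ext N e X) (e |: (t |: B)).
  by rewrite principal_ext_rkU1 ?notinU.
have sU : e |: (t |: B) \subset e |: (t |: (y |: B)) by rewrite !setUS ?subsetUr.
apply: leq_trans (rk_mono _ sU) _; rewrite principal_ext_rkU1 ?notinU //.
by rewrite (subset_trans XyB (cl_mono N (subsetUr _ _))) absorb // ry.
Qed.

(** * Ranks in the free cone *)

Section Cone.
Variables (T : finType) (M : matroid T) (m : nat).
Hypotheses (m_gt0 : 0 < m) (loopM : loopless M).
Notation U := (cone_type T m).
Notation tip := (tip T m).
Implicit Types (A : {set U}) (B : {set T}) (x : T) (y : U).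

(* The projection of A from the tip onto M. *)
Definition shadow A : {set T} :=
  [set x | (inl x \in A) || [exists i, inr (Some (x, i)) \in A]].

Lemma shadow_inl x A : shadow (inl x |: A) = x |: shadow A.
Proof.
apply/setP=> z; rewrite !inE -orbA; congr (_ || _).
by congr (_ || _); apply: eq_existsb => i; rewrite !inE.
Qed.

Lemma shadow_free p A : shadow (inr (Some p) |: A) = p.1 |: shadow A.
Proof.
case: p => x i; apply/setP=> z; rewrite !inE /=; apply/orP/orP.
  case=> [zA|/existsP[j]]; first by right; rewrite zA.
  rewrite !inE => /orP[/eqP[-> _]|zA]; first by left.
  by right; apply/orP; right; apply/existsP; exists j.
case=> [/eqP ->|/orP[zA|/existsP[j zA]]]; [right | by left | right].
  by apply/existsP; exists i; rewrite !inE eqxx.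
by apply/existsP; exists j; rewrite inE zA orbT.
Qed.

Lemma shadow_tip A : shadow (tip |: A) = shadow A.
Proof.
apply/setP=> z; rewrite !inE; congr (_ || _).
by apply: eq_existsb => i; rewrite !inE.
Qed.

Lemma shadow_imset B : shadow (inl @: B) = B.
Proof.
apply/setP=> z; rewrite inE mem_imset; last exact: inl_inj.
by apply/orP/idP => [[//|/existsP[i /imsetP[]]//]|]; left.
Qed.

Lemma shadow_set0 : shadow set0 = set0.
Proof. by rewrite -(imset0 inl) shadow_imset. Qed.

(** The invariant of the fold building the cone, with [s] the elements added so far. Its rank clause
    for sets with the tip says that contracting the tip makes each added element parallel to the
    element of [M] on its line. *)
Definition partial_cone (N : matroid U) (s : seq (T * 'I_m)) : Prop :=
  [/\ forall y, y \in ground N = match y with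
        | inl x => x \in ground M
        | inr None => true
        | inr (Some p) => p \in s
        end,
      forall A, A \subset ground N -> tip \in A -> rk N A = (rk M (shadow A)).+1,
      forall B, rk N (inl @: B) = rk M B &
      forall p, p \in s -> freely_on N tip (inr (Some p))].

Lemma partial_cone_base : partial_cone (add_coloop (cone_base M m) tip) [::].
Proof.
have gE y : y \in ground (add_coloop (cone_base M m) tip) = match y with
        | inl x => x \in ground M | inr None => true | inr (Some p) => false end.
  rewrite /= inE /base_ground; case: y => [x|[p|]]; rewrite !inE ?eqxx //=.
    by rewrite mem_imset //; apply: inl_inj.
  by apply/imsetP=> -[].
have pre A : inl @^-1: (A :\ tip) = inl @^-1: A by apply/setP=> x; rewrite !inE.
split=> // [A AE tA|B].
  rewrite /= /coloop_rk tA addn1 /= /base_rk pre; congr (rk M _).+1.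
  apply/setP=> x; rewrite !inE; case: (boolP [exists i, _]); rewrite ?orbF //.
  by case/existsP=> i /(subsetP AE); rewrite gE.
rewrite /= /coloop_rk /= /base_rk pre.
have -> : (tip \in inl @: B) = false by apply/imsetP=> -[].
rewrite addn0; congr (rk M _).
by apply/setP=> x; rewrite inE mem_imset //; apply: inl_inj.
Qed.

Lemma partial_cone_ext N s p : p.1 \in ground M ->
    partial_cone N s ->
  partial_cone (principal_ext N (inr (Some p)) (cl N [set tip; inl p.1])) (rcons s p).
Proof.
move=> pE [gE rT rI fr]; set e : U := inr (Some p); set X := cl N _.
have lE : [set tip; inl p.1] \subset ground N by rewrite subUset !sub1set !gE.
have tX : tip \in X by rewrite (subsetP (cl_sub lE)) // !inE eqxx.
split=> [y|A AE tA|B|q].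
- rewrite inE gE; case: y => [x|[q|]] /=; rewrite !inE ?orbT //.
  by rewrite mem_rcons inE.
- set B := A :\ e; have tB : tip \in B by rewrite !inE.
  have BE : B \subset ground N.
    by apply/subsetP=> y /setD1P[ye /(subsetP AE)/setU1P[yE|//]]; rewrite yE eqxx in ye.
  have eB : e \notin B by rewrite !inE eqxx.
  have [eA|eA] := boolP (e \in A); last first.
    rewrite principal_ext_rk // rT //.
    by apply/subsetP=> y yA; apply: (subsetP BE); rewrite !inE yA andbT; apply: contraNneq eA => <-.
  have -> : A = e |: B by rewrite setD1K.
  rewrite principal_ext_rkU1 // shadow_free.
  (* [B] contains the tip, so it spans the line [X] exactly when it spans [inl p.1], which [rT]
     reads off the shadow. *)
  have -> : (X \subset cl N B) = (rk M (p.1 |: shadow B) == rk M (shadow B)).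
    have -> : (X \subset cl N B) = (inl p.1 \in cl N B).
      apply/idP/idP => [/subsetP|xB].
        by apply; rewrite (subsetP (cl_sub lE)) // !inE eqxx orbT.
      by rewrite cl_min ?cl_flat // subUset !sub1set xB (subsetP (cl_sub BE)).
    rewrite inE gE pE /= !rT ?shadow_inl ?eqSS //; last by rewrite inE tB orbT.
    by rewrite subUset sub1set gE pE.
  rewrite rT //; case: eqP => [->//|/eqP ne]; congr _.+1.
  apply/eqP; rewrite eqn_leq rkU1 andbT ltn_neqAle eq_sym ne.
  by rewrite rk_mono ?subsetUr.
- by rewrite principal_ext_rk //; apply/imsetP=> -[].
rewrite mem_rcons inE; have [-> _|qp] := eqVneq q p.
  exact: principal_ext_free_new.
by move=> /= /fr; apply: principal_ext_free_old.
Qed.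

Lemma free_cone_partial :
  partial_cone (free_cone M m) (enum [set p : T * 'I_m | p.1 \in ground M]).
Proof.
have : all (fun p => p.1 \in ground M) (enum [set p : T * 'I_m | p.1 \in ground M]).
  by apply/allP=> p; rewrite mem_enum inE.
rewrite /free_cone; elim/last_ind: (enum _) => [|s p IHs].
  by move=> _; apply: partial_cone_base.
by rewrite all_rcons foldl_rcons => /andP[pE /IHs]; apply: partial_cone_ext.
Qed.

Notation Q := (free_cone M m).

Lemma cone_ground y : y \in ground Q = match y with
  | inl x => x \in ground M
  | inr None => true
  | inr (Some p) => p.1 \in ground M
  end.
Proof.
have [-> _ _ _] := free_cone_partial.
by case: y => [//|[p|//]]; rewrite mem_enum inE.
Qed.

Lemma cone_rk A : A \subset ground Q -> tip \in A -> rk Q A = (rk M (shadow A)).+1.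
Proof. by have [_ h _ _] := free_cone_partial; apply: h. Qed.

Lemma cone_rk_imset B : rk Q (inl @: B) = rk M B.
Proof. by have [_ _ h _] := free_cone_partial; apply: h. Qed.

Lemma cone_free p : p.1 \in ground M -> freely_on Q tip (inr (Some p)).
Proof.
by move=> pE; have [_ _ _ h] := free_cone_partial; apply: h; rewrite mem_enum inE.
Qed.

Lemma tip_ground : tip \in ground Q.
Proof. by rewrite cone_ground. Qed.

Lemma cone_proj y : y \in ground Q -> y != tip ->
  exists2 x, x \in ground M & forall A, shadow (y |: A) = x |: shadow A.
Proof.
rewrite cone_ground; case: y => [x|[[x i]|]] //= xE _; exists x => // A.
  exact: shadow_inl.
exact: shadow_free.
Qed.

Lemma inl_ground B : B \subset ground M -> inl @: B \subset ground Q.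
Proof. by move=> BE; apply/subsetP=> _ /imsetP[x /(subsetP BE) xE ->]; rewrite cone_ground. Qed.

Lemma tip_notin_cl_inl B : B \subset ground M -> tip \notin cl Q (inl @: B).
Proof.
move=> BE; rewrite inE tip_ground /= cone_rk ?shadow_tip ?shadow_imset ?cone_rk_imset.
- by rewrite -[X in _ == X]addn0 -addn1 eqn_add2l.
- by rewrite subUset sub1set tip_ground inl_ground.
by rewrite setU11.
Qed.

Lemma cone_rank : rank Q = (rank M).+1.
Proof.
rewrite /rank cone_rk ?tip_ground //; congr (rk M _).+1.
apply/setP=> x; rewrite inE cone_ground.
by apply/orP/idP => [[//|/existsP[i]]|]; [rewrite cone_ground | left].
Qed.

(** * The free cone as an instance of the tipped matroid *)

Lemma cone_rk_tip2 y : y \in ground Q -> y != tip -> rk Q [set tip; y] = 2.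
Proof.
move=> yE yt; have [x xE sh] := cone_proj yE yt.
rewrite setUC cone_rk ?sh ?inE ?eqxx ?orbT ?subUset ?sub1set ?yE ?tip_ground //.
by rewrite -[[set tip]]setU0 shadow_tip shadow_set0 setU0 rk1_loopless.
Qed.

Lemma cone_loopless : loopless Q.
Proof.
have rt : rk Q [set tip] = 1.
  rewrite cone_rk ?sub1set ?tip_ground ?inE //.
  by rewrite -[[set tip]]setU0 shadow_tip shadow_set0 rk_set0.
move=> y yE; have [->|yt] := eqVneq y tip; first by rewrite rt.
apply/eqP=> r0; have := cone_rk_tip2 yE yt.
have := rk_submod Q [set tip] [set y]; rewrite rt r0.
by move=> /(leq_trans (leq_addr _ _)) le h; rewrite h in le.
Qed.

(** Besides the tip, the line contains an element [u] of [M] and, as [m] is positive, an added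
    element [v]. Any two of these three span the line, so each [z] on it is spanned by such a pair
    not containing it, which gives a circuit through [z]. *)
Lemma cone_tip_line y : y \in ground Q -> y != tip -> cyclic Q (cl Q [set tip; y]).
Proof.
move=> yE yt; have sE : [set tip; y] \subset ground Q.
  by rewrite subUset !sub1set tip_ground.
set L := cl Q _; have fL : flat Q L by rewrite cl_flat.
have LE := flat_ground fL; have rL : rk Q L = 2 by rewrite rk_cl // cone_rk_tip2.
have [x xE sh] := cone_proj yE yt.
have tL : tip \in L by rewrite (subsetP (cl_sub sE)) // !inE eqxx.
have inL z : z \in ground Q -> (forall A, shadow (z |: A) = x |: shadow A) -> z \in L.
  move=> zE shz; apply: mem_cl => //.
  rewrite [[set tip; y]]setUC cone_rk ?sh ?shz ?inE ?eqxx ?orbT //.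
    rewrite [in leqRHS]cone_rk ?sh ?inE ?eqxx ?orbT ?setUA ?setUid //.
    by rewrite subUset !sub1set yE tip_ground.
  by rewrite !subUset !sub1set yE zE tip_ground.
pose u : U := inl x; pose v : U := inr (Some (x, Ordinal m_gt0)).
have uE : u \in ground Q by rewrite cone_ground.
have vE : v \in ground Q by rewrite cone_ground.
have uL : u \in L by apply: inL => // A; apply: shadow_inl.
have vL : v \in L by apply: inL => // A; apply: shadow_free.
have circ p q z : p \in L -> q \in L -> rk Q [set p; q] = 2 -> z \in L ->
    z \notin [set p; q] -> exists C, [/\ circuit Q C, z \in C & C \subset L].
  move=> pL qL rpq zL zN; have pqL : [set p; q] \subset L by rewrite subUset !sub1set pL.
  have pqE := subset_trans pqL LE.
  have zcl : z \in cl Q [set p; q].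
    suff -> : cl Q [set p; q] = L by [].
    apply: (@flat_rk_eq _ Q); [exact: cl_flat | exact: LE | exact: cl_min |].
    by rewrite rL rk_cl // rpq.
  have [C [Cc zC CU]] := circuit_through pqE zcl zN.
  by exists C; split=> //; rewrite (subset_trans CU) // subUset sub1set zL.
apply/cyclicP=> z zL; have [->|zt] := eqVneq z tip.
  apply: (circ u v) => //; last by rewrite !inE.
  apply/eqP; rewrite eqn_leq -{1}rL rk_mono ?subUset ?sub1set ?uL //= ltnNge.
  (* If [u] and [v] were parallel, freeness of [v] would put the tip in the closure of [u]. *)
  apply/negP=> ruv; have := @tip_notin_cl_inl [set x]; rewrite sub1set => /(_ xE).
  rewrite imset_set1 -/u inE tip_ground /= => /eqP; apply.
  apply: (@cone_free (x, Ordinal m_gt0) xE [set u]); first by rewrite !inE.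
  have ru := rk1_loopless cone_loopless uE.
  apply/eqP; rewrite eqn_leq (rk_mono _ (subsetUr _ _)) andbT ru.
  by rewrite setUC.
have [zu|zu] := eqVneq z u.
  by apply: (circ tip v) => //; rewrite ?cone_rk_tip2 // !inE zu.
by apply: (circ tip u) => //; rewrite ?cone_rk_tip2 // !inE (negPf zt).
Qed.

(** An added element in the closure would, by freeness, bring in the tip. *)
Lemma inl_flat : flat Q (inl @: ground M).
Proof.
have BE := inl_ground (subxx (ground M)).
rewrite /flat BE eqEsubset cl_sub // andbT; apply/subsetP=> y ycl.
have tN := tip_notin_cl_inl (subxx (ground M)).
have := subsetP (cl_ground _ _) y ycl; rewrite cone_ground.
case: y ycl => [x|[p|]] ycl pE; first exact: imset_f.
  case/negP: tN; rewrite inE tip_ground; apply/eqP/(cone_free pE).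
    by apply/imsetP=> -[].
  by move: ycl; rewrite inE => /andP[_ /eqP].
by rewrite ycl in tN.
Qed.

(** If a circuit [C] in [G] contained an added element [e], then [C :\ e] would span [e], hence by
    freeness the tip, which would then lie in the flat [G]. *)
Lemma tip_free_sub (G : cyclic_flat Q) : tip \notin cf_set G -> G \subset inl @: ground M.
Proof.
move=> tG; apply/subsetP=> y yG; have := subsetP (cf_ground G) y yG.
rewrite cone_ground; case: y yG => [x|[p|]] yG pE; first exact: imset_f.
  set e : U := inr (Some p) in yG.
  have /cyclicP/(_ e yG)[C [Cc eC CG]] := cf_cyclic G.
  have /minsetP[/andP[CE dC] minC] := Cc.
  have CeE : C :\ e \subset ground Q := subset_trans (subD1set _ _) CE.
  have clG := cl_min (cf_flat G) (subset_trans (subD1set C e) CG).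
  case/negP: tG; apply: (subsetP clG).
  rewrite inE tip_ground; apply/eqP/(cone_free pE); first by rewrite !inE eqxx.
  rewrite setD1K //; apply/eqP; rewrite eqn_leq (rk_mono Q (subD1set C e)) andbT.
  rewrite -ltnS (leq_trans dC) // (cardsD1 e) eC add1n ltnS leqNgt.
  apply/negP=> dCe; have eCe : C :\ e = C by apply: minC; rewrite ?subD1set // /dependent CeE.
  by move: eC; rewrite -eCe !inE eqxx.
by rewrite yG in tG.
Qed.

(** By [tip_free_sub] all circuits inside such a [G] lie in the copy of [M], so the union of all
    circuits in this copy works; it is a flat because the copy is one. *)
Lemma cone_Gmax : exists2 Gmax : cyclic_flat Q, tip \notin cf_set Gmax
  & forall G : cyclic_flat Q, tip \notin cf_set G -> G \subset Gmax.
Proof.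
have [Gmax GE] := cf_exists (cyclic_part_flat inl_flat) (cyclic_part_cyclic _ _).
exists Gmax; rewrite GE.
  by apply/negP=> /(subsetP (cyclic_partS _ _))/imsetP[].
move=> G tG; apply/subsetP=> y yG; have /cyclicP/(_ y yG)[C [Cc yC CG]] := cf_cyclic G.
by apply: (subsetP (cyclic_part_sup Cc _)) yC; apply: subset_trans CG (tip_free_sub tG).
Qed.

(** [G] lies in the copy of [M], and [L] contains a point [inl x] of this copy, which is off [G].
    Adding [inl x] raises the rank, and adding the tip raises it again because all the rest is in
    the copy. *)
Lemma cone_skew (G L : cyclic_flat Q) : tip \notin cf_set G -> tip \in cf_set L ->
  rk Q L = 2 -> G :&: L = set0 -> rk Q G + 2 <= rk Q (G :|: L).
Proof.
move=> tG tL rL GL; have LE := cf_ground L.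
have [y yL yt] : exists2 y, y \in cf_set L & y != tip.
  have /subsetPn[y yL] : ~~ (L \subset [set tip]); last by rewrite inE; exists y.
  apply/negP=> /(rk_mono Q) => le; have := leq_trans le (rk_card _ _).
  by rewrite rL cards1.
have yE := subsetP LE y yL; have [x xE sh] := cone_proj yE yt.
have uE : inl x \in ground Q by rewrite cone_ground.
have xL : inl x \in cf_set L.
  have /andP[_ /eqP <-] := cf_flat L; apply: mem_cl => //.
  rewrite !cone_rk ?inE ?tL ?orbT ?subUset ?sub1set ?uE //.
  by rewrite shadow_inl -{2}(setUidPr (_ : [set y] \subset L)) ?sub1set // sh.
have xG : inl x \notin cf_set G.
  by apply/negP=> xG; have : inl x \in cf_set G :&: L; [rewrite inE xG | rewrite GL inE].
have rx := rk_notin_flat (cf_flat G) uE xG.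
pose Z := shadow G.
have GZ : cf_set G = inl @: Z.
  apply/setP=> z; apply/idP/imsetP => [zG|[w]].
    have /imsetP[w _ zw] := subsetP (tip_free_sub tG) z zG.
    by exists w => //; rewrite inE -zw zG.
  rewrite inE => /orP[wG ->//|/existsP[i /(subsetP (tip_free_sub tG))/imsetP[]//]].
have sub : tip |: (inl x |: G) \subset G :|: L.
  by rewrite !subUset !sub1set !inE tL xL !orbT subsetUl.
apply: leq_trans (rk_mono _ sub); rewrite [leqRHS]cone_rk ?setU11 //; last first.
  by rewrite !subUset !sub1set tip_ground uE cf_ground.
rewrite shadow_tip shadow_inl -/Z addn2 ltnS -rx GZ.
by rewrite -imset_set1 -imsetU cone_rk_imset.
Qed.

End Cone.

Theorem theorem6p3 (T : finType) (M : matroid T) (m : nat) :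
  0 < m -> loopless M -> 2 < rank M -> configuration_unique (free_cone M m).
Proof.
move=> m_gt0 loopM rkM U N [cE [Phi [bijPhi PhiI PhiU cardPhi rkPhi]]].
have [Gmax GmaxN Gmax_sup] := cone_Gmax M m.
have rkQ : 3 < rank (free_cone M m) by rewrite cone_rank.
exact: (tipped_isomorphic (cone_loopless loopM) (tip_ground M m) (cone_rk_tip2 loopM)
  (cone_tip_line m_gt0 loopM) GmaxN Gmax_sup (@cone_skew _ M m) rkQ
  cE bijPhi PhiI PhiU cardPhi rkPhi).
Qed.
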